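(* Let $G$ be a connected cograph of order $n \ge 3$. Then $M_G\geq \tfrac{n}{2}+\tfrac{1}{3\cdot 2^{n-2}}$, with equality if and only if $G\cong S_n$.
   Context: All graphs are finite and simple; the order of a graph is its number of vertices. A graph is a cograph if it contains no induced path on $4$ vertices. For a graph $G$ of order $n$, let $a_k(G)$ be the number of $k$-element vertex subsets of $G$ that induce a connected subgraph (single vertices count as connected), and let $\Phi_G(x)=\sum_{k=1}^n a_k(G)x^k$. The global mean of $G$ is $M_G=\Phi_G'(1)/\Phi_G(1)$. $G_1\cup G_2$ denotes the disjoint union and $G_1+G_2$ the join of graphs (the disjoint union together with all edges between $G_1$ and $G_2$). For $n\ge 3$, the $n$-skillet is $S_n=K_1+(K_1\cup K_{n-2})$. *)

(* Defs.v *)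
From HB Require Import structures.
From mathcomp Require Import all_boot all_order all_algebra.

Set Implicit Arguments.
Unset Strict Implicit.
Unset Printing Implicit Defensive.

Import Order.TTheory GRing.Theory Num.Theory.

Local Open Scope ring_scope.

Record sgraph := SGraph {
  vertex :> finType;
  adj : rel vertex;
  adj_sym : symmetric adj;
  adj_irrefl : irreflexive adj }.

Arguments adj {G} x y : rename.

Definition isomorphic (G H : sgraph) : Prop :=
  exists2 f : G -> H, bijective f & forall x y, adj (f x) (f y) = adj x y.

Section Induced.
Variables (G : sgraph) (A : {set G}).

Definition induced_adj : rel {x : G | x \in A} := fun x y => adj (val x) (val y).

Fact induced_adj_sym : symmetric induced_adj.
Proof. by move=> x y; apply: adj_sym. Qed.

Fact induced_adj_irrefl : irreflexive induced_adj.
Proof. by move=> x; apply: adj_irrefl. Qed.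

Definition induced : sgraph := SGraph induced_adj_sym induced_adj_irrefl.

End Induced.

Section Complete.
Variable n : nat.

Definition complete_adj : rel 'I_n := fun x y => x != y.

Fact complete_adj_sym : symmetric complete_adj.
Proof. by move=> x y; rewrite /complete_adj eq_sym. Qed.

Fact complete_adj_irrefl : irreflexive complete_adj.
Proof. by move=> x; rewrite /complete_adj eqxx. Qed.

Definition complete_graph : sgraph := SGraph complete_adj_sym complete_adj_irrefl.

End Complete.

Section Path.
Variable n : nat.

Definition path_adj : rel 'I_n := fun x y => (x.+1 == y) || (y.+1 == x).

Fact path_adj_sym : symmetric path_adj.
Proof. by move=> x y; rewrite /path_adj orbC. Qed.

Fact path_adj_irrefl : irreflexive path_adj.
Proof. by move=> x; rewrite /path_adj orbb gtn_eqF. Qed.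

Definition path_graph : sgraph := SGraph path_adj_sym path_adj_irrefl.

End Path.

Section UnionJoin.
Variables G H : sgraph.

(* [b] is the adjacency between vertices on different sides: [false] gives
   the disjoint union, [true] gives the join. *)
Definition sum_adj (b : bool) : rel (G + H)%type := fun u v =>
  match u, v with
  | inl x, inl y => adj x y
  | inr x, inr y => adj x y
  | _, _ => b
  end.

Fact sum_adj_sym b : symmetric (sum_adj b).
Proof. by case=> x [] y //=; apply: adj_sym. Qed.

Fact sum_adj_irrefl b : irreflexive (sum_adj b).
Proof. by case=> x /=; apply: adj_irrefl. Qed.

Definition disjoint_union : sgraph :=
  SGraph (sum_adj_sym false) (sum_adj_irrefl false).

Definition join : sgraph := SGraph (sum_adj_sym true) (sum_adj_irrefl true).

End UnionJoin.

(* Only meaningful for [3 <= n]; the subtraction is truncated otherwise. *)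
Definition skillet (n : nat) : sgraph :=
  join (complete_graph 1)
       (disjoint_union (complete_graph 1) (complete_graph (n - 2))).

Definition connected (G : sgraph) : bool :=
  (0 < #|G|)%N && [forall x : G, forall y : G, connect adj x y].

Definition cograph (G : sgraph) : Prop :=
  forall A : {set G}, ~ isomorphic (induced A) (path_graph 4).

Definition num_connected (G : sgraph) (k : nat) : nat :=
  #|[set A : {set G} | (#|A| == k) && connected (induced A)]|.

Definition connected_set_poly (G : sgraph) : {poly rat} :=
  \sum_(1 <= k < #|G|.+1) (num_connected G k)%:R *: 'X^k.

Definition global_mean (G : sgraph) : rat :=
  (connected_set_poly G)^`().[1] / (connected_set_poly G).[1].

(* Main.v *)
(* Let D be the sum of [2 #|A| - n] over the connected sets A, and N their
   number; then M_G - n/2 = D / (2N). Summing over all subsets gives zero, so D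
   is n plus the sum of [n - 2 #|A|] over the nonempty disconnected sets, and N
   is [2^n - 1 - d], d being the number of these. Both sums follow a cotree: in
   a join X + Y the disconnected sets are those of X and those of Y, and in a
   disjoint union one adds all sets that meet both sides. Write E_c(S) for the
   sum of [c - 2 #|A|] over the disconnected subsets A of S. By induction
   E_c(S) >= 0 when [c >= #|S| + 2], and one more decomposition of S gives
   E_c(S) >= 1 - #|S| for [c = #|S| + 1].
   A connected cograph G is a join X + Y, so D >= n >= 3 unless one side is a
   single vertex; then D >= 2. If D >= 3 the bound is strict because
   N < 2^n = 4 * 2^(n-2). If D = 2, the other side is K_1 together with some H,
   or a disjoint union of two graphs of order 2, and this gives
   [d + 1 >= 2^(n-2)], that is N <= 3 * 2^(n-2), with equality only when the
   other side is K_1 together with a clique. *)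

Require Import Defs.
From mathcomp Require Import all_boot all_order all_algebra.
From mathcomp Require Import zify ring.

Set Implicit Arguments.
Unset Strict Implicit.
Unset Printing Implicit Defensive.

Import Order.TTheory GRing.Theory Num.Theory.

Local Open Scope ring_scope.

Lemma isomorphic_of_inj (G H : sgraph) (f : G -> H) :
    injective f -> #|H| = #|G| -> (forall x y, adj (f x) (f y) = adj x y) ->
  isomorphic G H /\ isomorphic H G.
Proof.
move=> f_inj cardHG f_adj; have f_bij : bijective f.
  by apply: inj_card_bij f_inj _; rewrite cardHG.
split; first by exists f.
case: (f_bij) => g fK gK; exists g; first by exists f.
by move=> x y; rewrite -f_adj !gK.
Qed.

(** * Seinsche's theorem: P4-free graphs split as disjoint unions or joins *)

Section CrossPartition.
Variable T : finType.
Implicit Types (e : rel T) (S C X Y : {set T}).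

Definition bipartition S X Y :=
  [/\ X != set0, Y != set0, [disjoint X & Y] & X :|: Y = S].

Definition cross e b X Y := {in X & Y, forall x y, e x y = b}.

Definition splits e b S := exists X Y, bipartition S X Y /\ cross e b X Y.

Definition P4_free e := forall a b c d,
  e a b -> e b c -> e c d -> [|| e a c, e a d | e b d].

Definition compl e : rel T := fun x y => (x != y) && ~~ e x y.

Lemma compl_sym e : symmetric e -> symmetric (compl e).
Proof. by move=> e_sym x y; rewrite /compl eq_sym e_sym. Qed.

(** The path on four vertices is self-complementary: an induced path a - b - c - d of the complement
    is an induced path b - d - a - c of [e]. *)
Lemma compl_P4_free e : symmetric e -> P4_free e -> P4_free (compl e).
Proof.
move=> e_sym P4e a b c d ab bc cd.
apply: contraT; rewrite !negb_or => /and3P[nac nad nbd].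
have e_of x y : x != y -> ~~ compl e x y -> e x y.
  by move=> neq_xy; rewrite /compl neq_xy negbK.
have ac : e a c by apply: e_of => //; apply: contraNneq nad => ->.
have ad : e a d.
  by apply: e_of => //; apply: contraNneq nbd => <-; rewrite compl_sym.
have bd : e b d by apply: e_of => //; apply: contraNneq nad => <-.
move: ab bc cd => /andP[_ ab] /andP[_ bc] /andP[_ cd].
have := P4e b d a c bd; rewrite e_sym ad => /(_ isT ac).
by rewrite e_sym (negPf ab) (negPf bc) e_sym (negPf cd).
Qed.

(* If [v] has a neighbour both in [C] and in [S :\: C], then either an edge of [C] from a non-neighbour [x] of [v] to a
   neighbour [y] starts an induced path x - y - v - z, or the non-neighbours
   of [v] in [C] form a smaller set with the same properties as [C]. *)
Lemma splits_setU1_cut e S v C :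
    symmetric e -> P4_free e -> v \notin S -> C \proper S ->
    cross e false C (S :\: C) -> (exists2 u, u \in C & ~~ e v u) ->
  splits e false (v |: S).
Proof.
move=> e_sym P4e vS; have [m] := ubnP #|C|.
elim: m C => // m IHm C leCm CpS crC [u uC vu].
have CS := proper_sub CpS; have /properP[_ [w wS wC]] := CpS.
have vC : v \notin C by apply: contraNN vS; apply: (subsetP CS).
have [/existsP[y /andP[yC vy]]|noC] := boolP [exists y, (y \in C) && e v y];
  last first.
  exists C, (v |: (S :\: C)); split; first split.
  - by apply/set0Pn; exists u.
  - by apply/set0Pn; exists v; rewrite setU11.
  - rewrite -setI_eq0; apply/eqP/setP=> x; rewrite !inE.
    by have [->|] := eqVneq x v; rewrite ?(negPf vC) //=; case: (x \in C).
  - by rewrite setUCA setDE setUIr setUCr setIT (setUidPr CS).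
  move=> x z xC; rewrite in_setU1 => /orP[/eqP->|]; last exact: crC.
  by apply: contraNF noC => xv; apply/existsP; exists x; rewrite xC e_sym.
have [/existsP[z /andP[zSC vz]]|noSC] :=
    boolP [exists z, (z \in S :\: C) && e v z]; last first.
  exists (S :\: C), (v |: C); split; first split.
  - by apply/set0Pn; exists w; rewrite inE wC.
  - by apply/set0Pn; exists v; rewrite setU11.
  - rewrite -setI_eq0; apply/eqP/setP=> x; rewrite !inE.
    have [->|] := eqVneq x v; rewrite ?(negPf vS) ?andbF //=.
    by case: (x \in C); rewrite ?andbF.
  - by rewrite setUCA [_ :|: C]setUC setDE setUIr setUCr setIT (setUidPr CS).
  move=> x z xSC; rewrite in_setU1 => /orP[/eqP->|zC].
    by apply: contraNF noSC => xv; apply/existsP; exists x; rewrite xSC e_sym.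
  by rewrite e_sym; apply: crC.
pose N := [set x in C | ~~ e v x].
have NC : N \subset C by apply/subsetP=> x; rewrite inE => /andP[].
have crN : cross e false N (C :\: N).
  move=> x t; rewrite !inE => /andP[xC vx] /andP[].
  move=> + tC; rewrite tC negbK => vt; apply/negP=> xt.
  have := P4e x t v z xt; rewrite e_sym vt => /(_ isT vz).
  by rewrite e_sym (negPf vx) crC // crC.
have NpC : N \proper C.
  by apply/properP; split=> //; exists y; rewrite // inE vy andbF.
apply: (IHm N).
- by rewrite (leq_trans (proper_card NpC)).
- exact: proper_trans CpS.
- move=> x t xN; rewrite inE => /andP[tN tS].
  have [tC|tC] := boolP (t \in C); first by apply: crN; rewrite // inE tN.
  by apply: crC; [apply: (subsetP NC) | rewrite inE tC].
- by exists u; rewrite // inE uC.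
Qed.

(** If [v] is adjacent to all of [S], then [v] against [S] is a join. Otherwise some non-neighbour
    of [v] lies in one of the two parts, and that part serves as [C] in [splits_setU1_cut]. *)
Lemma splits_setU1 e S v :
    symmetric e -> P4_free e -> v \notin S -> splits e false S ->
  splits e false (v |: S) \/ splits e true (v |: S).
Proof.
move=> e_sym P4e vS [X [Y [[X0 Y0 dXY XYS] crXY]]].
have [/forallP all_v|] := boolP [forall u, (u \in S) ==> e v u].
  right; exists [set v], S; split; first split=> //.
  - by apply/set0Pn; exists v; rewrite set11.
  - by apply: contraNneq X0 => S0; rewrite -subset0 -S0 -XYS subsetUl.
  - by rewrite disjoints1.
  by move=> x y /set1P-> yS; apply: (implyP (all_v y)).
rewrite negb_forall => /existsP[u]; rewrite negb_imply => /andP[uS vu]; left.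
have uXY : u \in X :|: Y by rewrite XYS.
wlog uX : X Y X0 Y0 dXY XYS crXY uXY / u \in X.
  case/setUP: (uXY) => [uX|uY] wlogX; first exact: (wlogX X Y).
  apply: (wlogX Y X) => //; first by rewrite disjoint_sym.
  - by rewrite setUC.
  - by move=> x y xY yX; rewrite e_sym crXY.
  - by rewrite setUC.
have SX : S :\: X = Y.
  by rewrite -XYS setDUl setDv set0U; apply/setDidPl; rewrite disjoint_sym.
apply: (@splits_setU1_cut _ _ _ X) => //; last by exists u.
  rewrite properEneq -XYS subsetUl andbT; apply: contraNneq Y0.
  by move=> XE; rewrite -SX -XYS -XE setDv.
by rewrite SX.
Qed.

Lemma splits_compl e b S : splits e b S -> splits (compl e) (~~ b) S.
Proof.
case=> X [Y [[X0 Y0 dXY XYS] crXY]]; exists X, Y; split=> // x y xX yY.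
rewrite /compl (crXY x y xX yY); case: eqP => // xy.
by move: dXY; rewrite disjoint_subset => /subsetP/(_ x xX); rewrite inE xy yY.
Qed.

Lemma splits_of_compl e b S : splits (compl e) b S -> splits e (~~ b) S.
Proof.
case=> X [Y [[X0 Y0 dXY XYS] crXY]]; exists X, Y; split=> // x y xX yY.
rewrite -(crXY x y xX yY) /compl; case: eqP => [xy|]; last by rewrite negbK.
by move: dXY; rewrite disjoint_subset => /subsetP/(_ x xX); rewrite inE xy yY.
Qed.

(** Induction by removing one vertex. Only union splits are extended directly; a join split is a
    union split of the complement, which is again P4-free. *)
Lemma P4_free_splits e S :
  symmetric e -> P4_free e -> (1 < #|S|)%N -> exists b, splits e b S.
Proof.
move=> e_sym P4e; have [m] := ubnP #|S|; elim: m S => // m IHm S leSm S_gt1.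
have /card_gt0P[v vS] : (0 < #|S|)%N by apply: ltnW.
have vS' : v \notin S :\ v by rewrite setD11.
have cardS : #|S| = (#|S :\ v|).+1 by rewrite (cardsD1 v) vS.
rewrite -(setD1K vS); move: (S :\ v) vS' cardS => S' vS' cardS.
have [S'gt1|] := ltnP 1 #|S'|; last first.
  move=> S'le1; have /cards1P[w defS'] : #|S'| == 1%N by lia.
  rewrite defS' in vS' *; exists (e v w), [set v], [set w]; split; first split.
  - by apply/set0Pn; exists v; rewrite set11.
  - by apply/set0Pn; exists w; rewrite set11.
  - by rewrite disjoints1.
  - by [].
  by move=> x y /set1P-> /set1P->.
case: (IHm S' _ S'gt1); first by rewrite cardS in leSm.
case=> [spl|spl]; last first.
  have [] := splits_setU1 e_sym P4e vS' spl; first by exists false.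
  by exists true.
have spl' : splits (compl e) false S' := splits_compl spl.
have [] := splits_setU1 (compl_sym e_sym) (compl_P4_free e_sym P4e) vS' spl'.
  by exists true; apply: (@splits_of_compl _ false).
by exists false; apply: (@splits_of_compl _ true).
Qed.

End CrossPartition.

Lemma cograph_P4_free (G : sgraph) : cograph G -> P4_free (@adj G).
Proof.
move=> coG a b c d ab bc cd; apply: contraT.
rewrite !negb_or => /and3P[nac nad nbd]; exfalso.
have neq x y : adj x y -> x != y :> G.
  by apply: contraTneq => ->; rewrite adj_irrefl.
(* Non-consecutive vertices are distinct, since identifying two of them would make an edge coincide
   with a missing one: a = c turns the edge cd into ad. *)
have ac : a != c by apply: contraNneq nad => ->.
have ad : a != d by apply: contraNneq nbd => <-; rewrite adj_sym.
have bd : b != d by apply: contraNneq nad => <-.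
pose s := [:: a; b; c; d].
have s_uniq : uniq s.
  by rewrite /= !inE !negb_or ac ad bd !neq.
pose A := [set x in s]; apply: (coG A).
have in_A (i : path_graph 4) : nth a s i \in A by rewrite inE mem_nth.
pose f (i : path_graph 4) : induced A := Sub (nth a s i) (in_A i).
have f_inj : injective f.
  move=> i j /(congr1 val) /= /eqP; rewrite (nth_uniq a _ _ s_uniq) //.
  by move/eqP/val_inj.
case: (isomorphic_of_inj f_inj) => //.
  rewrite card_sig card_ord -[4%N]/(size s) -(card_uniqP s_uniq).
  by apply: eq_card => x; rewrite !inE.
move=> i j; rewrite /f /= /induced_adj /=.
case: i => [[|[|[|[|i]]]] lei] //=; case: j => [[|[|[|[|j]]]] lej] //=;
  rewrite ?adj_irrefl ?ab ?bc ?cd ?(negPf nac) ?(negPf nad) ?(negPf nbd) //;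
  by rewrite adj_sym ?ab ?bc ?cd ?(negPf nac) ?(negPf nad) ?(negPf nbd).
Qed.

(** * Sums over connected, disconnected and arbitrary subsets *)

Section ConnectedSubsets.
Variable G : sgraph.
Implicit Types (A S X Y K : {set G}) (F : {set G} -> int).

Definition clique K := {in K &, forall x y, x != y -> adj x y}.

Definition disc A := (A != set0) && ~~ connected (induced A).

Lemma card_induced A : #|induced A| = #|A|.
Proof. by rewrite card_sig; apply: eq_card => x; rewrite inE. Qed.

Lemma connected_neq0 A : connected (induced A) -> A != set0.
Proof. by case/andP; rewrite card_induced card_gt0. Qed.

Lemma clique_connected K :
  clique K -> K != set0 -> connected (induced K).
Proof.
move=> cliqueK K0; rewrite /connected card_induced card_gt0 K0 /=.
apply/forallP=> x; apply/forallP=> y.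
have [->|neq_xy] := eqVneq x y; first exact: connect0.
by apply: connect1; apply: cliqueK; rewrite ?(valP x) ?(valP y).
Qed.

(** Vertices of [A] on opposite sides are adjacent; two on the same side are linked through a vertex
    of [A] on the other side. *)
Lemma join_connected A X Y :
    cross adj true X Y -> A \subset X :|: Y ->
  ~~ (A \subset X) -> ~~ (A \subset Y) -> connected (induced A).
Proof.
move=> crXY /subsetP AXY /subsetPn[y0 y0A y0X] /subsetPn[x0 x0A x0Y].
have x0X : x0 \in X by case/setUP: (AXY _ x0A) => //; rewrite (negPf x0Y).
have y0Y : y0 \in Y by case/setUP: (AXY _ y0A) => //; rewrite (negPf y0X).
pose x1 : induced A := Sub x0 x0A; pose y1 : induced A := Sub y0 y0A.
have con_xy (x y : induced A) : val x \in X -> val y \in Y -> connect adj x y.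
  by move=> xX yY; apply: connect1; apply: crXY.
have con_yx (x y : induced A) : val x \in X -> val y \in Y -> connect adj y x.
  by move=> xX yY; apply: connect1; rewrite adj_sym; apply: crXY.
rewrite /connected card_induced card_gt0; apply/andP; split.
  by apply/set0Pn; exists x0.
apply/forallP=> u; apply/forallP=> v.
have /setUP uXY := AXY _ (valP u); have /setUP vXY := AXY _ (valP v).
case: uXY vXY => [uX|uY] [vX|vY]; [|exact: con_xy|exact: con_yx|].
  exact: connect_trans (con_xy u y1 uX y0Y) (con_yx v y1 vX y0Y).
exact: connect_trans (con_yx x1 u x0X uY) (con_xy x1 v x0X vY).
Qed.

(** The vertices of [A] lying in [X] are closed under adjacency, so no walk inside [A] leaves
    [X]. *)
Lemma union_disc A X Y :
    cross adj false X Y -> A \subset X :|: Y ->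
  ~~ (A \subset X) -> ~~ (A \subset Y) -> disc A.
Proof.
move=> crXY /subsetP AXY /subsetPn[y yA yX] /subsetPn[x xA xY].
have xX : x \in X by case/setUP: (AXY _ xA) => //; rewrite (negPf xY).
apply/andP; split; first by apply/set0Pn; exists y.
apply/negP=> /andP[_ /forallP conA].
pose x1 : induced A := Sub x xA; pose y1 : induced A := Sub y yA.
have /forallP/(_ y1) con_xy := conA x1.
have cl : closed (@adj (induced A)) [pred u : induced A | val u \in X].
  move=> u v uv; rewrite !inE; apply/idP/idP => [uX|vX]; apply: contraTT uv.
    move=> vX; case/setUP: (AXY _ (valP v)) => [|vY]; first by rewrite (negPf vX).
    by rewrite /= /induced_adj crXY.
  move=> uX; case/setUP: (AXY _ (valP u)) => [|uY]; first by rewrite (negPf uX).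
  by rewrite /= /induced_adj adj_sym crXY.
by have := closed_connect cl con_xy; rewrite !inE xX (negPf yX).
Qed.

Definition subset_sum F S := \sum_(A : {set G} | (A \subset S) && (A != set0)) F A.

Definition disc_sum F S := \sum_(A : {set G} | (A \subset S) && disc A) F A.

Definition ndisc := disc_sum (fun=> 1).

(* With [c = n], the order of [G], this is the contribution of the
   disconnected subsets of [S] to the sum of [2 #|A| - n] over the connected
   subsets [A] of [G]. *)
Definition excess (c : int) := disc_sum (fun A => c - 2 * #|A|%:Z).

(** Only the empty set lies in both sides, so requiring nonempty sets prevents double counting. *)
Lemma bipartition_sum (Q : pred {set G}) F S X Y :
    bipartition S X Y -> (forall A, Q A -> A != set0) ->
  \sum_(A : {set G} | (A \subset S) && Q A) F A =
    \sum_(A : {set G} | (A \subset X) && Q A) F A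
    + \sum_(A : {set G} | (A \subset Y) && Q A) F A
    + \sum_(A : {set G} | [&& A \subset S, ~~ (A \subset X), ~~ (A \subset Y) & Q A]) F A.
Proof.
move=> [X0 Y0 dXY XYS] Q0.
have XS : X \subset S by rewrite -XYS subsetUl.
have YS : Y \subset S by rewrite -XYS subsetUr.
rewrite (bigID (fun A : {set G} => A \subset X)) /= -addrA; congr (_ + _).
  apply: eq_bigl => A; case AX: (A \subset X); last by rewrite andbF.
  by rewrite (subset_trans AX XS) andbT.
rewrite (bigID (fun A : {set G} => A \subset Y)) /=; congr (_ + _).
  apply: eq_bigl => A; case AY: (A \subset Y); last by rewrite andbF.
  rewrite (subset_trans AY YS) /= andbT; case QA: (Q A) => //=.
  apply/negP=> AX; have /negP := Q0 A QA; apply.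
  by rewrite -subset0 -(disjoint_setI0 dXY) subsetI AX.
apply: eq_bigl => A; case: (A \subset S) => //=.
by case: (A \subset X); case: (A \subset Y); rewrite ?andbT ?andbF.
Qed.

Lemma subset_sum_mixed F S X Y :
    bipartition S X Y ->
  \sum_(A : {set G} | [&& A \subset S, ~~ (A \subset X), ~~ (A \subset Y) & A != set0]) F A
    = subset_sum F S - subset_sum F X - subset_sum F Y.
Proof.
move=> bpS; rewrite /subset_sum (@bipartition_sum (fun A => A != set0) F _ _ _ bpS) //; ring.
Qed.

Lemma disc_neq0 A : disc A -> A != set0.
Proof. by case/andP. Qed.

Lemma disc_sum_join F S X Y :
    bipartition S X Y -> cross adj true X Y ->
  disc_sum F S = disc_sum F X + disc_sum F Y.
Proof.
move=> bpS crXY; rewrite /disc_sum (bipartition_sum F bpS disc_neq0).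
rewrite [X in _ + X]big1 ?addr0 // => A /and4P[AS AX AY].
case: bpS AS => _ _ _ <- AS /andP[_ /negP[]].
exact: join_connected crXY AS AX AY.
Qed.

Lemma disc_sum_union F S X Y :
    bipartition S X Y -> cross adj false X Y ->
  disc_sum F S = disc_sum F X + disc_sum F Y
    + (subset_sum F S - subset_sum F X - subset_sum F Y).
Proof.
move=> bpS crXY; rewrite /disc_sum (bipartition_sum F bpS disc_neq0).
congr (_ + _); rewrite -subset_sum_mixed //; apply: eq_bigl => A.
have [AS /=|//] := boolP (A \subset S); have [//|AX /=] := boolP (A \subset X).
have [//|AY /=] := boolP (A \subset Y).
case: bpS AS => _ _ _ <- AS.
by have dA := union_disc crXY AS AX AY; rewrite dA disc_neq0.
Qed.

Lemma disc_sum_clique F K : clique K -> disc_sum F K = 0.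
Proof.
move=> cliqueK; apply: big1 => A /and3P[/subsetP AK A0 /negP[]].
by apply: clique_connected => // x y /AK xK /AK yK; apply: cliqueK.
Qed.

Lemma clique_card_le1 S : (#|S| <= 1)%N -> clique S.
Proof. by move=> /card_le1_eqP S1 x y xS yS; rewrite (S1 x y xS yS) eqxx. Qed.

Lemma ndisc_ge0 S : 0 <= ndisc S.
Proof. by apply: sumr_ge0. Qed.

(** A non-adjacent pair is itself a disconnected set. This identifies the clique in the equality
    case. *)
Lemma ndisc_eq0_clique S : ndisc S = 0 -> clique S.
Proof.
move=> nd0 x y xS yS neq_xy; apply: contraTT isT => nxy.
have dxy : disc [set x; y].
  apply: (@union_disc _ [set x] [set y]) => //.
  - by move=> _ _ /set1P-> /set1P->; apply: negbTE.
  - by apply/subsetPn; exists y; rewrite !inE ?eqxx ?orbT // eq_sym.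
  - by apply/subsetPn; exists x; rewrite !inE ?eqxx.
have xyS : [set x; y] \subset S by rewrite subUset !sub1set xS.
move/eqP: nd0; rewrite /ndisc /disc_sum (bigD1 [set x; y]) ?xyS //=.
by rewrite paddr_eq0 ?sumr_ge0.
Qed.

Lemma subset_sumE F S :
  subset_sum F S = \sum_(A in powerset S) F A - F set0.
Proof.
rewrite (bigD1 set0) ?powersetE ?sub0set //= addrC addrK.
by apply: eq_bigl => A; rewrite powersetE.
Qed.

Lemma subset_sum1 S : subset_sum (fun=> 1) S = (2 ^ #|S|)%:Z - 1.
Proof. by rewrite subset_sumE sumr_const card_powerset natz. Qed.

(** Each [A] is paired with its complement in [S]; the two sizes add up to [#|S|]. *)
Lemma sum_card_powerset S :
  \sum_(A in powerset S) (2 * #|A|%:Z) = #|S|%:Z * (2 ^ #|S|)%:Z.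
Proof.
have setD_sum : \sum_(A in powerset S) #|A|%:Z =
    \sum_(A in powerset S) #|S :\: A|%:Z.
  rewrite (reindex_onto (fun A => S :\: A) (fun A => S :\: A)) /=; last first.
    by move=> A; rewrite powersetE => AS; rewrite setDDr setDv set0U (setIidPr AS).
  apply: eq_bigl => A; rewrite !powersetE subsetDl /= setDDr setDv set0U.
  by apply/eqP/idP => [<-|/setIidPr //]; rewrite subsetIl.
have -> : \sum_(A in powerset S) (2 * #|A|%:Z) =
    \sum_(A in powerset S) #|A|%:Z + \sum_(A in powerset S) #|A|%:Z.
  by rewrite -big_split; apply: eq_bigr => A _; rewrite mulr_natl mulr2n.
rewrite {2}setD_sum -big_split /= (eq_bigr (fun=> #|S|%:Z)); last first.
  move=> A; rewrite powersetE => AS; rewrite cardsD (setIidPr AS).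
  by have := subset_leq_card AS; lia.
by rewrite sumr_const card_powerset -mulr_natr natz.
Qed.

Lemma subset_sum_linear (c : int) S :
  subset_sum (fun A => c - 2 * #|A|%:Z) S = (c - #|S|%:Z) * (2 ^ #|S|)%:Z - c.
Proof.
rewrite subset_sumE cards0 sumrB sum_card_powerset sumr_const card_powerset.
rewrite -mulr_natr natz; ring.
Qed.

End ConnectedSubsets.

(** * Bounds on the excess and their equality cases *)

Section Excess.
Variable G : sgraph.
Implicit Types (S X Y K : {set G}).

Lemma bipartition_card S X Y : bipartition S X Y ->
  [/\ (0 < #|X|)%N, (0 < #|Y|)%N & #|S| = (#|X| + #|Y|)%N].
Proof.
move=> [X0 Y0 dXY XYS]; rewrite !card_gt0; split=> //.
by rewrite -XYS -cardsUI (disjoint_setI0 dXY) cards0 addn0.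
Qed.

Lemma bipartition_sym S X Y : bipartition S X Y -> bipartition S Y X.
Proof. by move=> [X0 Y0 dXY XYS]; split; rewrite // 1?disjoint_sym // setUC. Qed.

Lemma cross_sym b X Y : cross (@adj G) b X Y -> cross adj b Y X.
Proof. by move=> crXY x y xY yX; rewrite adj_sym crXY. Qed.

(** The last bracket is the sum over sets meeting both sides, arranged to isolate c - |S|, the
    quantity that the later bounds control. *)
Lemma excess_union c S X Y (a := (2 ^ #|X|)%:Z) (b := (2 ^ #|Y|)%:Z) :
    bipartition S X Y -> cross adj false X Y ->
  excess c S = excess c X + excess c Y
    + ((c - #|X|%:Z - #|Y|%:Z) * (a - 1) * (b - 1)
       - #|Y|%:Z * (a - 1) - #|X|%:Z * (b - 1)).
Proof.
move=> bpS crXY; rewrite /excess (disc_sum_union _ bpS crXY).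
rewrite !subset_sum_linear; have [_ _ ->] := bipartition_card bpS.
rewrite expnD /a /b !PoszD !PoszM; ring.
Qed.

Lemma ndisc_union S X Y :
    bipartition S X Y -> cross adj false X Y ->
  ndisc S = ndisc X + ndisc Y
    + ((2 ^ #|X|)%:Z - 1) * ((2 ^ #|Y|)%:Z - 1).
Proof.
move=> bpS crXY; rewrite /ndisc (disc_sum_union _ bpS crXY) !subset_sum1.
have [_ _ ->] := bipartition_card bpS; rewrite expnD !PoszM; ring.
Qed.

(** The inequality 2m <= 2^m is an equality exactly at m = 1 and m = 2, which are kept apart because
    they govern the equality cases. *)
Lemma expn2_cases m : (0 < m)%N ->
  [\/ m = 1%N /\ 2 ^ m = 2, m = 2 /\ 2 ^ m = 4 | 3 <= m /\ 2 * m < 2 ^ m]%N.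
Proof.
case: m => // -[|[|m]] _; [by constructor 1|by constructor 2|constructor 3].
by split=> //; elim: m => // m IHm; rewrite expnS; lia.
Qed.

Hypothesis G_P4_free : P4_free (@adj G).

Lemma P4_free_splits_adj S : (1 < #|S|)%N ->
  exists b X Y, bipartition S X Y /\ cross adj b X Y.
Proof. exact: P4_free_splits (@adj_sym G) G_P4_free. Qed.

Lemma excess_ge0 (c : int) S : #|S|%:Z + 2 <= c -> 0 <= excess c S.
Proof.
have [m] := ubnP #|S|; elim: m S => // m IHm S leSm leSc.
have [S_gt1|S_le1] := ltnP 1 #|S|; last first.
  by rewrite /excess disc_sum_clique //; apply: clique_card_le1.
have [b [X [Y [bpS crXY]]]] := P4_free_splits_adj S_gt1.
have [X_gt0 Y_gt0 cardS] := bipartition_card bpS.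
have eX : 0 <= excess c X by apply: IHm; lia.
have eY : 0 <= excess c Y by apply: IHm; lia.
case: b crXY => crXY.
  by rewrite /excess (disc_sum_join _ bpS crXY) addr_ge0.
rewrite (excess_union c bpS crXY) addr_ge0 ?(addr_ge0 eX) //.
have := ltn_expl #|X| (ltnSn 1); have := ltn_expl #|Y| (ltnSn 1).
move: (2 ^ #|X|)%N (2 ^ #|Y|)%N leSc; rewrite cardS {eX eY bpS crXY cardS X_gt0 Y_gt0}.
move: #|X| #|Y| => x y a b lec ltyb ltxa.
have u0 : 0 <= a%:Z - 1 - x%:Z by lia.
have v0 : 0 <= b%:Z - 1 - y%:Z by lia.
have a0 : 0 <= a%:Z - 1 by lia.
have b0 : 0 <= b%:Z - 1 by lia.
have k0 : 0 <= c - x%:Z - y%:Z - 2 by lia.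
(* Since c - x - y >= 2, two copies of (a - 1)(b - 1) are available; they absorb y(a - 1) and x(b -
   1) because x <= a - 1 and y <= b - 1. *)
have -> : (c - x%:Z - y%:Z) * (a%:Z - 1) * (b%:Z - 1)
      - y%:Z * (a%:Z - 1) - x%:Z * (b%:Z - 1) =
    (c - x%:Z - y%:Z - 2) * ((a%:Z - 1) * (b%:Z - 1))
      + (a%:Z - 1) * (b%:Z - 1 - y%:Z) + (a%:Z - 1 - x%:Z) * (b%:Z - 1) by ring.
by rewrite !addr_ge0 // !mulr_ge0.
Qed.

(** Both sides of a split have order at most |S| - 1, so [excess_ge0] applies to them with c = |S| +
    1 and only the mixed sets of a union can contribute negatively. *)
Lemma excess_lower S (n := #|S|.+1) : (0 < #|S|)%N ->
  1 - #|S|%:Z <= excess n S.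
Proof.
rewrite /n => S_gt0; have [S_gt1|S_le1] := ltnP 1 #|S|; last first.
  by rewrite /excess disc_sum_clique; [lia | apply: clique_card_le1].
have [b [X [Y [bpS crXY]]]] := P4_free_splits_adj S_gt1.
have [X_gt0 Y_gt0 cardS] := bipartition_card bpS.
have eX : 0 <= excess #|S|.+1 X by apply: excess_ge0; lia.
have eY : 0 <= excess #|S|.+1 Y by apply: excess_ge0; lia.
case: b crXY => crXY.
  rewrite /excess (disc_sum_join _ bpS crXY); move: eX eY; rewrite /excess; lia.
rewrite (excess_union _ bpS crXY).
have := expn2_cases X_gt0; have := expn2_cases Y_gt0; move: eX eY; rewrite cardS.
move: (excess _ X) (excess _ Y) (2 ^ #|X|)%N (2 ^ #|Y|)%N; move: #|X| #|Y|.
move=> x y eX eY a b eX0 eY0.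
(* Here the mixed sets contribute (a - 1 - x)(b - 1 - y) - xy. What remains is (a - 1 - x)(b - 1 -
   y) >= (x - 1)(y - 1), a consequence of a >= 2x and b >= 2y. *)
by case=> [[-> ->]|[-> ->]|[y3 yb]]; case=> [[-> ->]|[-> ->]|[x3 xa]]; nia.
Qed.

(** This is what is left of a skillet once its universal vertex is removed. *)
Definition vertex_clique_union S := exists p K,
  [/\ bipartition S [set p] K, cross adj false [set p] K & clique K].

Lemma vertex_clique_union_ndisc S : vertex_clique_union S -> ndisc S + 1 = (2 ^ #|S|.-1)%:Z.
Proof.
case=> p [K [bpS crpK cliqueK]]; rewrite (ndisc_union bpS crpK).
rewrite /ndisc !disc_sum_clique //; last by apply: clique_card_le1; rewrite cards1.
have [_ _ ->] := bipartition_card bpS; rewrite cards1 add1n /=; lia.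
Qed.

Lemma vertex_clique_union_excess S : vertex_clique_union S -> excess #|S|.+1 S = 1 - #|S|%:Z.
Proof.
case=> p [K [bpS crpK cliqueK]]; rewrite (excess_union _ bpS crpK).
rewrite /excess !disc_sum_clique //; last by apply: clique_card_le1; rewrite cards1.
have [_ _ ->] := bipartition_card bpS; rewrite cards1; lia.
Qed.

(** When [X] is a single vertex there are 2^|Y| - 1 mixed sets, so [ndisc S + 1] exceeds 2^(|S| - 1)
    by exactly [ndisc Y]. *)
Lemma pendant_split_ndisc S X Y :
    bipartition S X Y -> cross adj false X Y -> #|X| = 1%N ->
  (2 ^ #|S|.-1)%:Z <= ndisc S + 1 /\
  (ndisc S + 1 = (2 ^ #|S|.-1)%:Z -> vertex_clique_union S).
Proof.
move=> bpS crXY X1; have ndX : ndisc X = 0.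
  by rewrite /ndisc disc_sum_clique //; apply: clique_card_le1; rewrite X1.
rewrite (ndisc_union bpS crXY); have [_ _ ->] := bipartition_card bpS.
rewrite X1 add1n ndX /=; have ndY := ndisc_ge0 Y; split; first lia.
move=> ndY0; have /cards1P[p Xp] : #|X| == 1%N by rewrite X1.
by exists p, Y; rewrite -Xp; split=> //; apply: ndisc_eq0_clique; lia.
Qed.

(** A join has nonnegative excess, which is too large. For a union, equality in (a - 1 - x)(b - 1 -
    y) >= (x - 1)(y - 1) forces a side of order 1 or two sides of order 2. *)
Lemma excess_tight S : (1 < #|S|)%N -> excess #|S|.+1 S <= 1 - #|S|%:Z ->
  (2 ^ #|S|.-1)%:Z <= ndisc S + 1 /\
  (ndisc S + 1 = (2 ^ #|S|.-1)%:Z -> vertex_clique_union S).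
Proof.
move=> S_gt1; have [b [X [Y [bpS crXY]]]] := P4_free_splits_adj S_gt1.
have [X_gt0 Y_gt0 cardS] := bipartition_card bpS.
have eX : 0 <= excess #|S|.+1 X by apply: excess_ge0; lia.
have eY : 0 <= excess #|S|.+1 Y by apply: excess_ge0; lia.
case: b crXY => crXY.
  rewrite /excess (disc_sum_join _ bpS crXY); move: eX eY; rewrite /excess; lia.
have [X1 _|X_neq1] := eqVneq #|X| 1%N; first exact: pendant_split_ndisc bpS crXY X1.
have [Y1 _|Y_neq1] := eqVneq #|Y| 1%N.
  exact: pendant_split_ndisc (bipartition_sym bpS) (cross_sym crXY) Y1.
rewrite (excess_union _ bpS crXY) (ndisc_union bpS crXY).
have := ndisc_ge0 X; have := ndisc_ge0 Y.
case: (expn2_cases X_gt0) => [[X1]|[X2 aX]|[X3 aX]]; first by rewrite X1 in X_neq1.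
  case: (expn2_cases Y_gt0) => [[Y1]|[Y2 bY]|[Y3 bY]]; first by rewrite Y1 in Y_neq1.
    (* The nine mixed sets give [ndisc S + 1] >= 10 > 8 = 2^3, so equality cannot occur here. *)
    by rewrite cardS X2 Y2 -[(2 ^ (2 + 2).-1)%N]/8%N; split; lia.
  move: eX eY bY; rewrite cardS aX X2.
  move: (excess _ X) (excess _ Y) (2 ^ #|Y|)%N; move: #|Y| Y3 => y *; nia.
case: (expn2_cases Y_gt0) => [[Y1]|[Y2 bY]|[Y3 bY]]; first by rewrite Y1 in Y_neq1.
  move: eX eY aX; rewrite cardS bY Y2.
  move: (excess _ X) (excess _ Y) (2 ^ #|X|)%N; move: #|X| X3 => y *; nia.
move: eX eY aX bY; rewrite cardS.
move: (excess _ X) (excess _ Y) (2 ^ #|X|)%N (2 ^ #|Y|)%N.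
move: #|X| #|Y| X3 Y3 => x y *; nia.
Qed.

(** The skillet structure is described inside [G] by vertex sets, so that the subset sums apply
    without transport along an isomorphism. *)
Definition skillet_like := exists c X,
  [/\ bipartition setT [set c] X, cross adj true [set c] X & vertex_clique_union X].

Lemma skillet_like_excess (n := #|G|) : skillet_like ->
  n%:Z + excess n [set: G] = 2 /\ ndisc [set: G] + 1 = (2 ^ (n - 2))%:Z.
Proof.
rewrite /n => -[c [X [bpG crcX lolX]]]; have [_ _] := bipartition_card bpG.
rewrite cardsT cards1 add1n => cardG.
have clique_c : clique [set c] by apply: clique_card_le1; rewrite cards1.
have join_c F : disc_sum F [set: G] = disc_sum F X.
  by rewrite (disc_sum_join _ bpG crcX) (disc_sum_clique _ clique_c) add0r.
rewrite /excess /ndisc !join_c -/(excess _ X) -/(ndisc X) cardG.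
by rewrite vertex_clique_union_excess // vertex_clique_union_ndisc // subn2; split=> //; lia.
Qed.

Lemma connected_excess (n := #|G|) : (3 <= n)%N -> connected G ->
  3 <= n%:Z + excess n [set: G] \/
  [/\ n%:Z + excess n [set: G] = 2, (2 ^ (n - 2))%:Z <= ndisc [set: G] + 1
    & ndisc [set: G] + 1 = (2 ^ (n - 2))%:Z -> skillet_like].
Proof.
rewrite /n => n_ge3 G_con.
have T_gt1 : (1 < #|[set: G]|)%N by rewrite cardsT ltnW.
have [b [X [Y [bpG crXY]]]] := P4_free_splits_adj T_gt1.
have [X_gt0 Y_gt0] := bipartition_card bpG; rewrite cardsT => cardG.
have {b}crXY : cross adj true X Y.
  case: b crXY => // crXY; have [X0 Y0 dXY _] := bpG; exfalso.
  have [x xX] := set0Pn _ X0; have [y yY] := set0Pn _ Y0.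
  have /andP[_ /forallP/(_ x)/forallP/(_ y) con_xy] := G_con.
  (* In a union split [X] would be closed under adjacency, contradicting a walk from [x] to [y]. *)
  have cl : closed adj (mem X).
    move=> u v uv; have [_ _ _ XYT] := bpG.
    have /setUP uXY : u \in X :|: Y by rewrite XYT inE.
    have /setUP vXY : v \in X :|: Y by rewrite XYT inE.
    have dY w : w \in Y -> (w \in X) = false by move/(disjointFl dXY).
    case: uXY vXY uv => [uX|uY] [vX|vY]; rewrite ?uX ?vX ?(dY u) ?(dY v) //.
      by rewrite crXY.
    by rewrite adj_sym crXY.
  by have := closed_connect cl con_xy; rewrite xX (disjointFl dXY yY).
have excessT : excess #|G| [set: G] = excess #|G| X + excess #|G| Y.
  exact: disc_sum_join bpG crXY.
wlog leYX : X Y bpG crXY X_gt0 Y_gt0 cardG excessT / (#|X| <= #|Y|)%N.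
  move=> wlogXY; have [leXY|ltYX] := leqP #|X| #|Y|; first exact: (wlogXY X Y).
  apply: (wlogXY Y X) => //; last exact: ltnW.
  - exact: bipartition_sym.
  - exact: cross_sym.
  - by rewrite addnC.
  - by rewrite addrC.
have [X1|X_neq1] := eqVneq #|X| 1%N; last first.
  left; rewrite excessT.
  (* Both sides have at least two vertices, hence at most n - 2, as [excess_ge0] requires for c =
     n. *)
  have eX : 0 <= excess #|G| X by apply: excess_ge0; lia.
  have eY : 0 <= excess #|G| Y by apply: excess_ge0; lia.
  by rewrite -[3]addr0 lerD ?addr_ge0.
have clX : clique X by apply: clique_card_le1; rewrite X1.
have eX : excess #|G| X = 0 by rewrite /excess disc_sum_clique.
have defG : #|G| = #|Y|.+1 by rewrite cardG X1.
(* As n = |Y| + 1, this reads n + excess >= 2; an integer value below 3 must therefore be 2. *)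
have eY := excess_lower Y_gt0; rewrite -defG in eY.
have [le3|lt3] := lerP 3 (#|G|%:Z + excess #|G| [set: G]); [by left|right].
have Y_gt1 : (1 < #|Y|)%N by lia.
have eY1 : excess #|Y|.+1 Y <= 1 - #|Y|%:Z by rewrite -defG; lia.
have ndG : ndisc [set: G] = ndisc Y.
  by rewrite /ndisc (disc_sum_join _ bpG crXY) (disc_sum_clique _ clX) add0r.
have [ndY lolY] := excess_tight Y_gt1 eY1.
have n2 : (#|G| - 2 = #|Y|.-1)%N by rewrite defG subn2.
rewrite ndG n2; split=> //; first lia.
move=> /lolY lol; have /cards1P[c Xc] : #|X| == 1%N by rewrite X1.
by exists c, Y; rewrite -Xc.
Qed.

End Excess.

(** * Recognition of skillets up to isomorphism *)

Lemma skillet_like_isomorphic (G : sgraph) (n := #|G|) :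
  (3 <= n)%N -> skillet_like G -> isomorphic G (skillet n).
Proof.
rewrite /n => n_ge3 [c [X [bpG crcX [p [K [bpX crpK cliqueK]]]]]].
have [_ _] := bipartition_card bpG; have [_ _] := bipartition_card bpX.
rewrite cardsT !cards1 => -> cardG.
have cardK : (#|G| - 2 = #|K|)%N by rewrite cardG !add1n subn2.
pose g (i : 'I_(#|G| - 2)) : G := enum_val (cast_ord cardK i).
have gK i : g i \in K := enum_valP _.
have g_inj : injective g by move=> i j /enum_val_inj/cast_ord_inj.
have [[_ _ _ defX] [_ _ dcX _]] := (bpX, bpG).
have pX : p \in X by rewrite -defX setU11.
have KX : K \subset X by rewrite -defX subsetUr.
have neq_cX x : x \in X -> c != x.
  by move=> xX; apply: contraTneq xX => <-; rewrite (disjointFr dcX) ?set11.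
have neq_pK x : x \in K -> p != x.
  have [_ _ dpK _] := bpX.
  by move=> xK; apply: contraTneq xK => <-; rewrite (disjointFr dpK) ?set11.
have neq_cg i : c != g i by apply: neq_cX; apply: (subsetP KX).
have neq_pg i : p != g i by apply: neq_pK.
have neq_cp : c != p by apply: neq_cX.
have adj_c x : x \in X -> adj c x by move=> xX; apply: crcX; rewrite ?set11.
have adj_p i : adj p (g i) = false by apply: crpK; rewrite ?set11.
have adj_cg i : adj c (g i) by apply: adj_c; apply: (subsetP KX).
have adj_g i j : adj (g i) (g j) = (i != j).
  have [->|neq_ij] := eqVneq i j; first by rewrite adj_irrefl.
  by apply: cliqueK; rewrite ?gK // (inj_eq g_inj).
pose f (u : skillet #|G|) : G :=
  match u with inl _ => c | inr (inl _) => p | inr (inr i) => g i end.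
have f_inj : injective f.
  move=> [i|[i|i]] [j|[j|j]] //= /eqP; rewrite ?(eq_sym (g i));
    rewrite ?(eq_sym p c) ?(negPf neq_cp) ?(negPf (neq_cg _)) ?(negPf (neq_pg _)) //.
  - by rewrite (ord1 i) (ord1 j).
  - by rewrite (ord1 i) (ord1 j).
  - by rewrite (inj_eq g_inj) => /eqP->.
case: (isomorphic_of_inj f_inj) => //.
  by rewrite !card_sum !card_ord cardK cardG.
move=> [i|[i|i]] [j|[j|j]] //=;
  rewrite ?adj_irrefl ?adj_cg ?adj_c ?adj_p ?adj_g //.
- by rewrite /complete_adj (ord1 i) (ord1 j).
- by rewrite adj_sym adj_c.
- by rewrite /complete_adj (ord1 i) (ord1 j).
- by rewrite adj_sym adj_cg.
- by rewrite adj_sym adj_p.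
Qed.

Lemma isomorphic_skillet_like (G : sgraph) n :
  (3 <= n)%N -> isomorphic G (skillet n) -> skillet_like G.
Proof.
move=> n_ge3 [f [g fK gK] f_adj].
have g_inj : injective g := can_inj gK.
have g_adj u v : adj (g u) (g v) = adj u v by rewrite -f_adj !gK.
pose cs : skillet n := inl ord0; pose ps : skillet n := inr (inl ord0).
have lt0n : (0 < n - 2)%N by rewrite subn_gt0.
pose ks : skillet n := inr (inr (Ordinal lt0n)).
pose X := ~: [set g cs].
have fX x : x \in X -> exists u, x = g (inr u).
  rewrite !inE; case fx: (f x) => [i|u]; last by exists u; rewrite -fx fK.
  by rewrite -[x]fK fx (ord1 i) eqxx.
have pX : g ps \in X by rewrite !inE (inj_eq g_inj).
have fKX x : x \in X :\ g ps -> exists i, x = g (inr (inr i)).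
  case/setD1P => neq_xp /fX[[i|i] defx]; last by exists i.
  by rewrite defx (ord1 i) eqxx in neq_xp.
exists (g cs), X; split.
- split; [by apply/set0Pn; exists (g cs); rewrite set11
         |by apply/set0Pn; exists (g ps) | | exact: setUCr].
  by rewrite disjoints1 !inE eqxx.
- by move=> _ x /set1P-> /fX[u ->]; rewrite g_adj.
exists (g ps), (X :\ g ps); split.
- split; [by apply/set0Pn; exists (g ps); rewrite set11 | | | exact: setD1K].
    by apply/set0Pn; exists (g ks); rewrite !inE !(inj_eq g_inj).
  by rewrite disjoints1 setD11.
- by move=> _ x /set1P-> /fKX[i ->]; rewrite g_adj.
by move=> _ _ /fKX[i ->] /fKX[j ->]; rewrite g_adj (inj_eq g_inj).
Qed.

(** * The global mean in terms of subset sums *)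

Section GlobalMean.
Variable G : sgraph.
Let n := #|G|.

Lemma sum_num_connected (F : nat -> rat) :
  \sum_(1 <= k < n.+1) (num_connected G k)%:R * F k =
  \sum_(A : {set G} | connected (induced A)) F #|A|.
Proof.
transitivity (\sum_(1 <= k < n.+1) \sum_(A : {set G})
    if (#|A| == k) && connected (induced A) then F #|A| else 0).
  apply: eq_bigr => k _; rewrite -big_mkcond /= mulr_natl -sumr_const.
  by apply: eq_big => [A|A]; rewrite inE // => /andP[/eqP->].
rewrite exchange_big [RHS]big_mkcond; apply: eq_bigr => A _ /=.
case: ifP => [conA|_]; last by apply: big1 => k _; rewrite andbF.
rewrite (bigD1_seq #|A|) ?iota_uniq //= ?eqxx.
  by rewrite big1 ?addr0 // => k neq_kA; rewrite eq_sym (negPf neq_kA).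
(* Connected sets are nonempty, so starting the range at k = 1 loses none of them. *)
by rewrite mem_index_iota card_gt0 connected_neq0 // ltnS max_card.
Qed.

Lemma connected_set_poly_at1 :
  (connected_set_poly G).[1] = (\sum_(A : {set G} | connected (induced A)) 1)%:~R.
Proof.
rewrite /connected_set_poly horner_sum rmorph_sum -(sum_num_connected (fun=> 1)).
by apply: eq_bigr => k _; rewrite hornerZ hornerXn expr1n.
Qed.

Lemma deriv_connected_set_poly_at1 :
  (connected_set_poly G)^`().[1] =
  (\sum_(A : {set G} | connected (induced A)) #|A|%:Z)%:~R.
Proof.
rewrite /connected_set_poly linear_sum horner_sum rmorph_sum.
rewrite -(sum_num_connected (fun k => k%:R)); apply: eq_bigr => k _.
by rewrite /= derivZ derivXn hornerZ hornerMn hornerXn expr1n.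
Qed.

Lemma sum_connected (F : {set G} -> int) :
  \sum_(A : {set G} | connected (induced A)) F A =
  subset_sum F [set: G] - disc_sum F [set: G].
Proof.
apply/eqP; rewrite eq_sym subr_eq addrC; apply/eqP.
rewrite /subset_sum (bigID (fun A => disc A)) /=; congr (_ + _).
  by apply: eq_bigl => A; rewrite /disc; case: (A != set0); rewrite ?andbT ?andbF.
apply: eq_bigl => A; rewrite subsetT /disc /=.
by have [/connected_neq0->|_] := boolP (connected _); last case: (A != set0).
Qed.

Lemma card_connected :
  \sum_(A : {set G} | connected (induced A)) 1 =
  (2 ^ n)%:Z - 1 - ndisc [set: G].
Proof. by rewrite sum_connected subset_sum1 cardsT. Qed.

Lemma sum_card_connected :
  2 * (\sum_(A : {set G} | connected (induced A)) #|A|%:Z) =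
  n%:Z * (\sum_(A : {set G} | connected (induced A)) 1)
    + (n%:Z + excess n [set: G]).
Proof.
have := sum_connected (fun A => n%:Z - 2 * #|A|%:Z).
(* At c = n the sum over all subsets vanishes, and leaving out the empty set makes it -n. *)
rewrite subset_sum_linear cardsT subrr mul0r -/(excess _ _).
have -> : n%:Z * \sum_(A : {set G} | connected (induced A)) 1 =
    \sum_(A : {set G} | connected (induced A)) n%:Z.
  by rewrite mulr_sumr; apply: eq_bigr => A _; rewrite mulr1.
rewrite sumrB -mulr_sumr; set a := (X in X - 2 * _); set b := (X in a - 2 * X).
by rewrite -/a -/b; move: a b => a b; lia.
Qed.

(** Since the mean is n/2 + D/(2N), the gap is D/(2N) - 1/(3p); its sign is that of an integer. *)
Lemma global_mean_sub_bound (p N D : int) :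
    \sum_(A : {set G} | connected (induced A)) 1 = N -> 0 < N -> 0 < p ->
    n%:Z + excess n [set: G] = D ->
  global_mean G - (n%:R / 2 + 1 / (3 * p%:~R)) =
  (3 * p * D - 2 * N)%:~R / (6 * p * N)%:~R.
Proof.
move=> defN N_gt0 p_gt0 defD; have := sum_card_connected; rewrite defN defD.
rewrite /global_mean connected_set_poly_at1 deriv_connected_set_poly_at1 defN.
move: (\sum_(A | _) _) => W /(congr1 (fun z : int => z%:~R : rat)).
rewrite !rmorphB !rmorphD !rmorphM /= => defW.
have N0 : N%:~R != 0 :> rat by rewrite intr_eq0 gt_eqF.
have p0 : p%:~R != 0 :> rat by rewrite intr_eq0 gt_eqF.
have -> : W%:~R = (n%:R * N%:~R + D%:~R) / 2 :> rat.
  by rewrite -[n%:R]/(n%:Z%:~R) -defW; field.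
by field; rewrite N0 p0.
Qed.

End GlobalMean.

(** * The bound and its equality case *)

Theorem theorem4p7 (G : sgraph) (n : nat) (hn : #|G| = n) (n_ge3 : (3 <= n)%N)
    (G_connected : connected G) (G_cograph : cograph G) :
  global_mean G >= n%:R / 2 + 1 / (3 * 2 ^+ (n - 2)) /\
  (global_mean G = n%:R / 2 + 1 / (3 * 2 ^+ (n - 2)) <->
   isomorphic G (skillet n)).
Proof.
subst n; set p := (2 ^ (#|G| - 2))%:Z.
have -> : 2 ^+ (#|G| - 2) = p%:~R :> rat by rewrite /p -natrX.
have p_gt0 : 0 < p by rewrite /p ltz_nat expn_gt0.
pose d := ndisc [set: G]; pose D := #|G|%:Z + excess #|G| [set: G].
pose N := \sum_(A : {set G} | connected (induced A)) (1 : int).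
have d_ge0 : 0 <= d := ndisc_ge0 _.
(* With n >= 2 the subtraction n - 2 is not truncated, so 2^n = 4p. *)
have defN : N = 4 * p - 1 - d.
  by rewrite /N card_connected -[in LHS](subnK (ltnW n_ge3)) expnD PoszM mulrC.
have N_gt0 : 0 < N.
  have /card_gt0P[x _] : (0 < #|G|)%N by rewrite ltnW // ltnW.
  have con_x : connected (induced [set x]).
    by apply: clique_connected; rewrite -?card_gt0 ?cards1 //;
      apply: clique_card_le1; rewrite cards1.
  by rewrite /N (bigD1 [set x]) //= ltr_pwDl // sumr_ge0.
have gap := global_mean_sub_bound (erefl N) N_gt0 p_gt0 (erefl D).
have pN_gt0 : 0 < (6 * p * N)%:~R :> rat by rewrite ltr0z !mulr_gt0.
have [D_ge3|[D2 ledp lol]] := connected_excess (cograph_P4_free G_cograph) n_ge3 G_connected.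
  (* Strictness: 3pD >= 9p, whereas 2N < 8p. *)
  have gap_gt0 : 0 < (3 * p * D - 2 * N)%:~R / (6 * p * N)%:~R :> rat.
    by rewrite divr_gt0 // ltr0z defN; move: D_ge3; rewrite -/D; nia.
  rewrite -gap subr_gt0 in gap_gt0; split; first exact: ltW.
  split=> [eq_mean|iso_skillet]; first by rewrite eq_mean ltxx in gap_gt0.
  have [D2 _] := skillet_like_excess (isomorphic_skillet_like n_ge3 iso_skillet).
  by move: D_ge3; rewrite D2.
(* For D = 2 the numerator 6p - 2(4p - 1 - d) is 2(d + 1 - p), so both the bound and equality are
   statements about d + 1 and p. *)
have {}gap : global_mean G - (#|G|%:R / 2 + 1 / (3 * p%:~R)) =
    (2 * (d + 1 - p))%:~R / (6 * p * N)%:~R.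
  by rewrite gap; congr (_%:~R / _); rewrite /D D2 defN; ring.
split.
  rewrite -subr_ge0 gap; apply: divr_ge0; last exact: ltW.
  by rewrite ler0z; move: ledp; rewrite -/d -/p; lia.
split=> [/eqP|iso_skillet].
  rewrite -subr_eq0 gap mulf_eq0 invr_eq0 (gt_eqF pN_gt0) orbF intr_eq0 => /eqP dp.
  by apply: skillet_like_isomorphic => //; apply: lol; rewrite -/d -/p; lia.
apply/eqP; rewrite -subr_eq0 gap.
have [_] := skillet_like_excess (isomorphic_skillet_like n_ge3 iso_skillet).
by rewrite -/d -/p => ->; rewrite subrr mulr0 mul0r.
Qed.
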